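(* Let $r:\mathbb{F}^{\Sigma\times\Sigma\times\Sigma}\to\mathbb{R}_{\ge0}$ be any function which is sub-additive (if $A,B\in\mathbb{F}^{\Sigma\times\Sigma\times\Sigma}$ then $r(A+B)\le r(A)+r(B)$) and monotone under zeroing outs (if $B$ is a zeroing out of $A$ then $r(B)\le r(A)$). Suppose $P$ is any promise tensor over $\Sigma\times\Sigma\times\Sigma$ and $I\subset P$ is any problem (not necessarily a permutation problem). Then $\mathrm{cc}(I,P)\ge\log_2\left(\frac{r(I)}{r(P)}\right)$.
   Context: Subsets of $\Sigma^3$ are identified with $\{0,1\}$-valued tensors $\sum_{(a,b,c)\in S}x_ay_bz_c\in\mathbb{F}^{\Sigma\times\Sigma\times\Sigma}$ over a field $\mathbb{F}$. A zeroing out of $A$ is obtained by choosing $A'\subset\Sigma$, $B'\subset\Sigma$, $C'\subset\Sigma$ and setting to zero all coefficients outside $A'\times B'\times C'$. A promise problem $I\subset P\subset\Sigma^3$: players receive $a,b,c$ with $(a,b,c)\in P$ and decide whether $(a,b,c)\in I$. $\mathrm{cc}(I,P)$ is deterministic communication complexity in the shared-blackboard model (players in cyclic order append bits depending on own input and the board, or accept/reject; input accepted iff all accept; correctness required only on $P$; cost = maximum number of bits written). *)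

(* Defs.v *)
From mathcomp Require Import all_boot all_order all_algebra.
From mathcomp Require Import all_classical all_reals all_analysis.

Set Implicit Arguments.
Unset Strict Implicit.
Unset Printing Implicit Defensive.

Import Order.TTheory GRing.Theory Num.Theory.
Local Open Scope ring_scope.

Notation tensor F Sigma := {ffun Sigma * Sigma * Sigma -> F}.

Section Tensors.
Variables (F : fieldType) (Sigma : finType).

Definition tensor_of (S : {set Sigma * Sigma * Sigma}) : tensor F Sigma :=
  [ffun t => (t \in S)%:R].

Definition is_zeroing_out (B A : tensor F Sigma) : Prop :=
  exists A' B' C' : {set Sigma},
    forall a b c, B (a, b, c) =
      if [&& a \in A', b \in B' & c \in C'] then A (a, b, c) else 0.

End Tensors.

Section Communication.
Variable Sigma : finType.

(* Players are numbered 0, 1, 2 and move in the cyclic order 0, 1, 2, 0, 1, ...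
   In [Turn n msg next] the player to move, holding x, appends the n bits
   [msg x] to the board; [next] is indexed by what was appended, so a position
   in the tree is the content of the board, and each [msg] depends on the board
   and on the player's own input only.  The number of bits appended in a turn
   (possibly zero) and the moment at which the players stop and give their
   verdicts are functions of the board alone: otherwise the length of a message,
   or the choice to stop, would convey information that is not counted in the
   number of bits written. *)
Inductive protocol : Type :=
| Verdict (accept : 'I_3 -> Sigma -> bool)
| Turn (n : nat) (msg : Sigma -> n.-tuple bool)
       (next : n.-tuple bool -> protocol).

Definition input_of (x : Sigma * Sigma * Sigma) (i : 'I_3) : Sigma :=
  match val i with
  | 0 => x.1.1
  | 1 => x.1.2
  | _ => x.2
  end.

Fixpoint accepts_from (i : 'I_3) (p : protocol) (x : Sigma * Sigma * Sigma)
    : bool :=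
  match p with
  | Verdict accept => [forall j : 'I_3, accept j (input_of x j)]
  | Turn _ msg next => accepts_from (ordS i) (next (msg (input_of x i))) x
  end.

Fixpoint bits_from (i : 'I_3) (p : protocol) (x : Sigma * Sigma * Sigma)
    : nat :=
  match p with
  | Verdict _ => 0
  | Turn n msg next =>
      (n + bits_from (ordS i) (next (msg (input_of x i))) x)%N
  end.

Definition accepts : protocol -> Sigma * Sigma * Sigma -> bool :=
  accepts_from ord0.

Definition bits_written : protocol -> Sigma * Sigma * Sigma -> nat :=
  bits_from ord0.

Definition solves (p : protocol) (I P : {set Sigma * Sigma * Sigma}) : Prop :=
  forall x, x \in P -> accepts p x = (x \in I).

Definition cost (p : protocol) (P : {set Sigma * Sigma * Sigma}) : nat :=
  \max_(x in P) bits_written p x.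

(* Players 0 and 1 write down their inputs; player 2 then decides. *)
Lemma solvable_with_some_cost (I P : {set Sigma * Sigma * Sigma}) :
  exists k, `[< exists2 p, solves p I P & cost p P = k >].
Proof.
pose enc (a : Sigma) : #|Sigma|.-tuple bool := [tuple of map (pred1 a) (enum Sigma)].
have encI : injective enc.
  move=> a a' /(congr1 val) /= /eq_in_map /(_ a).
  by rewrite mem_enum /= eqxx => /(_ isT) /esym /eqP.
pose p := Turn enc (fun u => Turn enc (fun v => Verdict (fun j c =>
  (val j == 2%N) ==>
    [exists a, [exists b, [&& enc a == u, enc b == v & (a, b, c) \in I]]]))).
exists (cost p P); apply/asboolP; exists p => // -[[a b] c] _.
rewrite /accepts /=; apply/forallP/idP => [/(_ ord_max) | abcI j].
  rewrite /= => /existsP[a' /existsP[b' /and3P[/eqP/encI -> /eqP/encI ->]]].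
  by [].
apply/implyP => /eqP j2; have -> : j = ord_max by exact/val_inj.
by apply/existsP; exists a; apply/existsP; exists b; rewrite !eqxx.
Qed.

Definition cc (I P : {set Sigma * Sigma * Sigma}) : nat :=
  ex_minn (solvable_with_some_cost I P).

End Communication.

(* Base-2 logarithm with log2e 0 = -oo and log2e +oo = +oo. *)
Definition log2e (R : realType) (x : \bar R) : \bar R :=
  (lne x / (ln (2 : R))%:E)%E.

(* Main.v *)
Require Import Defs.
From mathcomp Require Import all_boot all_order all_algebra.
From mathcomp Require Import all_classical all_reals all_analysis.

Import Order.TTheory GRing.Theory Num.Theory.
Local Open Scope ring_scope.

(** For an arbitrary set [Q] of inputs on which at most [d] bits are written,
    the accepted part of [Q] has [r]-value at most [2 ^ d] times that of [Q].
    By induction on the protocol: the [2 ^ n] possible messages of an [n]-bit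
    turn split [Q] into zeroing outs of [Q] on which at most [d - n] further
    bits are written, and at a verdict the accepted part is itself a zeroing
    out of [Q].  Take for [Q] the promise and for [d] the cost. *)

Lemma subadditive_sum {V : nmodType} {R : numDomainType} (r : V -> R)
    (r_subadd : forall A B, r (A + B) <= r A + r B)
    (T : finType) (f : T -> V) : T ->
  r (\sum_t f t) <= \sum_t r (f t).
Proof.
(* [r 0] may be positive, so one summand is split off to start the induction. *)
move=> t0; rewrite (bigD1 t0) //= [leRHS](bigD1 t0) //=.
elim/big_rec2: _ (f t0) => [|t u v _ IH] A; first by rewrite !addr0.
rewrite !addrA; apply: (le_trans (IH _)).
by rewrite lerD2r r_subadd.
Qed.

(** Conditions imposed on each player's input separately cut out a box. Indexing its sides by ['I_3]
    lets verdicts and messages be treated alike. *)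
Lemma zeroing_out_box {F : fieldType} {Sigma : finType}
    (Q S : {set Sigma * Sigma * Sigma}) (D : 'I_3 -> {set Sigma}) :
  (forall x, (x \in S) = [forall j, input_of x j \in D j]) ->
  is_zeroing_out (tensor_of F (Q :&: S)) (tensor_of F Q).
Proof.
move=> SE; exists (D (inord 0)), (D (inord 1)), (D (inord 2)) => a b c.
have -> : [&& a \in D (inord 0), b \in D (inord 1) & c \in D (inord 2)] =
    ((a, b, c) \in S).
  rewrite SE; apply/and3P/forallP => [[Da Db Dc] j|D3].
    by rewrite -[j]inord_val; case: j => -[|[|[|]]] //= ?; rewrite /input_of /= inordK.
  by split; [move: (D3 (inord 0))|move: (D3 (inord 1))|move: (D3 (inord 2))];
    rewrite /input_of /= inordK.
by rewrite !ffunE inE; case: ifP; rewrite ?andbT ?andbF.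
Qed.

(** A message of player [i] restricts only side [i] of the box; the other two sides are all of
    [Sigma]. *)
Lemma zeroing_out_fiber {F : fieldType} {Sigma : finType} {T : eqType}
    (Q : {set Sigma * Sigma * Sigma}) (i : 'I_3) (f : Sigma -> T) (t : T) :
  is_zeroing_out (tensor_of F (Q :&: [set x | f (input_of x i) == t]))
    (tensor_of F Q).
Proof.
apply: (zeroing_out_box _ _ (fun j => [set a | (j == i) ==> (f a == t)])) => x.
rewrite inE; apply/idP/forallP => [ft j|/(_ i)]; last by rewrite inE eqxx.
by rewrite inE; apply/implyP => /eqP ->.
Qed.

Lemma tensor_of_fibers {F : fieldType} {Sigma T : finType}
    (S : {set Sigma * Sigma * Sigma}) (f : Sigma * Sigma * Sigma -> T) :
  tensor_of F S = \sum_t tensor_of F (S :&: [set x | f x == t]).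
Proof.
apply/ffunP => x; rewrite sum_ffunE ffunE (bigD1 (f x)) //= big1 => [|t tfx].
  by rewrite ffunE !inE eqxx andbT addr0.
by rewrite ffunE !inE eq_sym (negPf tfx) andbF.
Qed.

Lemma accepted_le {R : realType} {F : fieldType} {Sigma : finType}
    {r : tensor F Sigma -> R}
    (r_ge0 : forall A : tensor F Sigma, 0 <= r A)
    (r_subadd : forall A B : tensor F Sigma, r (A + B) <= r A + r B)
    (r_mono : forall A B : tensor F Sigma, is_zeroing_out B A -> r B <= r A)
    (p : protocol Sigma) (i : 'I_3) (Q : {set Sigma * Sigma * Sigma}) (d : nat) :
  (forall x, x \in Q -> (bits_from i p x <= d)%N) ->
  r (tensor_of F (Q :&: [set x | accepts_from i p x]))
    <= 2 ^+ d * r (tensor_of F Q).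
Proof.
(* This covers a verdict reached with part of the budget [d] left over. *)
have le_pow m A : r A <= 2 ^+ m * r A.
  by rewrite ler_peMl // exprn_ege1 // ler1n.
elim: p i Q d => [acc|n msg next IH] i Q d bits_le.
  apply: (le_trans _ (le_pow _ _)); apply: r_mono.
  apply: (zeroing_out_box _ _ (fun j => [set a | acc j a])) => x.
  by rewrite inE /=; apply: eq_forallb => j; rewrite inE.
(* An empty [Q] puts no constraint on [n], so [d - n] could be truncated. *)
case: (set_0Vmem Q) => [->|[x0 Qx0]]; first by rewrite finset.set0I.
have n_le_d : (n <= d)%N := leq_trans (leq_addr _ _) (bits_le _ Qx0).
pose sent w := [set x | msg (input_of x i) == w].
rewrite (tensor_of_fibers _ (fun x => msg (input_of x i))).
apply: le_trans (subadditive_sum r r_subadd _ _ (msg (input_of x0 i))) _.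
(* The factor [2 ^+ d] is shared equally among the [2 ^+ n] messages. *)
have -> : 2 ^+ d * r (tensor_of F Q) =
    \sum_(w : n.-tuple bool) 2 ^+ (d - n) * r (tensor_of F Q).
  rewrite sumr_const card_tuple card_bool -[RHS]mulr_natl natrX mulrA -exprD.
  by rewrite subnKC.
apply: ler_sum => w _.
(* On inputs that send [w], the protocol continues as the fixed subtree [next w]. *)
have -> : Q :&: [set x | accepts_from i (Turn msg next) x] :&: sent w =
    Q :&: sent w :&: [set x | accepts_from (ordS i) (next w) x].
  apply/setP => x; rewrite !inE /=.
  by case: eqP => [->|_]; rewrite ?andbT ?andbF.
apply: le_trans (IH w (ordS i) (Q :&: sent w) (d - n)%N _) _.
  move=> x; rewrite !inE => /andP[/bits_le /= + /eqP <-].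
  by rewrite leq_subRL.
by rewrite ler_wpM2l ?exprn_ge0 //; exact/r_mono/zeroing_out_fiber.
Qed.

Lemma log2e_div_le {R : realType} (x y : R) (k : nat) :
  0 <= x -> 0 <= y -> x <= 2 ^+ k * y ->
  (log2e (x%:E / y%:E) <= (k%:R : R)%:E)%E.
Proof.
have ln2_gt0 : 0 < ln (2 : R) by rewrite ln_gt0 // ltr1n.
move=> x_ge0 y_ge0 xy; rewrite /log2e.
(* For [x = 0] the quotient is 0 even if [y = 0], since [0 * +oo = 0]; its logarithm is [-oo]. *)
have [x0|x_neq0] := eqVneq x 0.
  rewrite x0 mul0e le0_lneNy // inver gt_eqF //.
  by rewrite gt0_mulNye ?leNye // lte_fin invr_gt0.
have x_gt0 : 0 < x by rewrite lt_neqAle eq_sym x_neq0.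
(* A positive [x] forces [y] to be positive, so the quotient is finite. *)
have y_gt0 : 0 < y.
  by rewrite -(pmulr_rgt0 _ (exprn_gt0 k (ltr0n R 2))) (lt_le_trans x_gt0).
have xy_gt0 : 0 < x / y by rewrite divr_gt0.
rewrite !inver !gt_eqF // -EFinM lne_EFin // -EFinM lee_fin ler_pdivrMr //.
rewrite mulr_natl -lnXn // ler_ln ?posrE ?exprn_gt0 //.
by rewrite ler_pdivrMr.
Qed.

Theorem mainTheorem14 (R : realType) (F : fieldType) (Sigma : finType)
    (r : tensor F Sigma -> R)
    (r_ge0 : forall A : tensor F Sigma, 0 <= r A)
    (r_subadd : forall A B : tensor F Sigma, r (A + B) <= r A + r B)
    (r_mono : forall A B : tensor F Sigma, is_zeroing_out B A -> r B <= r A)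
    (I P : {set Sigma * Sigma * Sigma}) (IP : I \subset P) :
  (log2e ((r (tensor_of F I))%:E / (r (tensor_of F P))%:E)
     <= ((cc I P)%:R : R)%:E)%E.
Proof.
rewrite /cc; case: ex_minnP => k /asboolP[p p_solves <-] _.
apply: log2e_div_le => //.
(* Outside [P] the answers of [p] are arbitrary; intersecting with [P] discards them, and loses
   nothing of [I] by [IP]. *)
have -> : I = P :&: [set x | accepts_from ord0 p x].
  apply/setP => x; rewrite !inE; case: (boolP (x \in P)) => [/p_solves <- //|].
  by apply: contraNF => /(fintype.subsetP IP).
apply: accepted_le => // x Px.
exact: (@leq_bigmax_cond _ (mem P) (bits_written p)).
Qed.
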